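(* Let $0<c<1$. For real numbers $\alpha,\beta,\gamma$ let $\boldsymbol{p}$ be the cubic triangular patch described in the context. Then $\boldsymbol{p}$ is $G^1$-admissible (in the sense of the context) if and only if $$\alpha=\frac{8-3c^2}{3(4-3c^2)},\qquad \beta=\frac{4}{3(4-3c^2)},\qquad \gamma=\frac{\sqrt{1-c^2}\,(8-8c^2+3c^4)}{2(1-c^2)(4-3c^2)}.$$ In other words, this is the only, and therefore the best, regular $G^1$ cubic patch of this form.
   Context: $\Delta=\{(u,v)\in\mathbb{R}^2:\ 0\le u,v\le 1,\ v\le 1-u\}$. For $0<c<1$ let $\boldsymbol{v}_0=(c,0,\sqrt{1-c^2})^T$, $\boldsymbol{v}_1=(-\tfrac12c,\tfrac{\sqrt3}{2}c,\sqrt{1-c^2})^T$, $\boldsymbol{v}_2=(-\tfrac12c,-\tfrac{\sqrt3}{2}c,\sqrt{1-c^2})^T$ be the vertices of an equilateral spherical triangle on the unit sphere. The cubic patch is $\boldsymbol{p}:\Delta\to\mathbb{R}^3$, $\boldsymbol{p}(u,v)=\sum_{i+j+k=3}\frac{3!}{i!j!k!}u^iv^j(1-u-v)^k\,\boldsymbol{b}_{i,j,k}$ (with $i,j,k$ nonnegative integers) with control points $\boldsymbol{b}_{3,0,0}=\boldsymbol{v}_0$, $\boldsymbol{b}_{0,3,0}=\boldsymbol{v}_1$, $\boldsymbol{b}_{0,0,3}=\boldsymbol{v}_2$, $\boldsymbol{b}_{2,1,0}=\alpha\boldsymbol{v}_0+\beta\boldsymbol{v}_1$, $\boldsymbol{b}_{2,0,1}=\alpha\boldsymbol{v}_0+\beta\boldsymbol{v}_2$,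 $\boldsymbol{b}_{1,2,0}=\alpha\boldsymbol{v}_1+\beta\boldsymbol{v}_0$, $\boldsymbol{b}_{0,2,1}=\alpha\boldsymbol{v}_1+\beta\boldsymbol{v}_2$, $\boldsymbol{b}_{1,0,2}=\alpha\boldsymbol{v}_2+\beta\boldsymbol{v}_0$, $\boldsymbol{b}_{0,1,2}=\alpha\boldsymbol{v}_2+\beta\boldsymbol{v}_1$, $\boldsymbol{b}_{1,1,1}=(0,0,\gamma)^T$. The patch is called $G^1$-admissible if: (1) it is regular: $\partial_u\boldsymbol{p}$ and $\partial_v\boldsymbol{p}$ are linearly independent at every point of $\Delta$; (2) at each of the three vertices $\boldsymbol{v}_m$ of the patch, all directional derivatives of $\boldsymbol{p}$ are perpendicular to $\boldsymbol{v}_m$; (3) at every point of each of the three boundary curves of the patch, the normal $\partial_u\boldsymbol{p}\times\partial_v\boldsymbol{p}$ lies in the plane through the origin and the two endpoints of that boundary curve. (These conditions ensure that the patch and its reflection over the plane of a boundary curve join with a common tangent plane along that curve.) *)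

(* Defs.v *)
From mathcomp Require Import all_boot all_order all_algebra.
From mathcomp Require Import all_classical all_reals all_analysis.
Set Implicit Arguments.
Unset Strict Implicit.
Unset Printing Implicit Defensive.
Import Order.TTheory GRing.Theory Num.Theory.
Import numFieldNormedType.Exports.
Local Open Scope ring_scope.

Definition vec2 (R : realType) (a b : R) : 'rV[R]_2 := \row_i [:: a; b]`_i.

Definition vec3 (R : realType) (a b d : R) : 'rV[R]_3 := \row_i [:: a; b; d]`_i.

Definition dotv (R : realType) (x y : 'rV[R]_3) : R := \sum_i x 0 i * y 0 i.

Definition crossv (R : realType) (x y : 'rV[R]_3) : 'rV[R]_3 :=
  vec3 (x 0 1 * y 0 2%:R - x 0 2%:R * y 0 1)
       (x 0 2%:R * y 0 0 - x 0 0 * y 0 2%:R)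
       (x 0 0 * y 0 1 - x 0 1 * y 0 0).

(* A point (u, v) of the plane is a row vector x with u = x 0 0, v = x 0 1. *)
Definition simplex (R : realType) : set 'rV[R]_2 :=
  [set x | [/\ 0 <= x 0 0 <= 1, 0 <= x 0 1 <= 1 & x 0 1 <= 1 - x 0 0]]%classic.

Section Patch.
Variables (R : realType) (c : R).

Definition v0 : 'rV[R]_3 := vec3 c 0 (Num.sqrt (1 - c ^+ 2)).
Definition v1 : 'rV[R]_3 :=
  vec3 (- (1 / 2) * c) (Num.sqrt 3 / 2 * c) (Num.sqrt (1 - c ^+ 2)).
Definition v2 : 'rV[R]_3 :=
  vec3 (- (1 / 2) * c) (- (Num.sqrt 3 / 2) * c) (Num.sqrt (1 - c ^+ 2)).

Variables alpha beta gamma : R.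

(* Only the values at i + j + k = 3 matter; the default is never used. *)
Definition ctrl (i j k : nat) : 'rV[R]_3 :=
  match i, j, k with
  | 3, 0, 0 => v0
  | 0, 3, 0 => v1
  | 0, 0, 3 => v2
  | 2, 1, 0 => alpha *: v0 + beta *: v1
  | 2, 0, 1 => alpha *: v0 + beta *: v2
  | 1, 2, 0 => alpha *: v1 + beta *: v0
  | 0, 2, 1 => alpha *: v1 + beta *: v2
  | 1, 0, 2 => alpha *: v2 + beta *: v0
  | 0, 1, 2 => alpha *: v2 + beta *: v1
  | 1, 1, 1 => vec3 0 0 gamma
  | _, _, _ => 0
  end.

(* The polynomial map is defined on the whole plane, so that its derivatives
   make sense at the boundary points of the simplex as well. *)
Definition cubic_patch (x : 'rV[R]_2) : 'rV[R]_3 :=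
  let u := x 0 0 in
  let v := x 0 1 in
  \sum_(i < 4) \sum_(j < 4) \sum_(k < 4 | (i + j + k == 3)%N)
    (3`!%:R / (i`! * j`! * k`!)%:R * u ^+ i * v ^+ j * (1 - u - v) ^+ k)
      *: ctrl i j k.

End Patch.

Section Admissible.
Variables (R : realType) (p : 'rV[R]_2 -> 'rV[R]_3).

Definition partial_u (x : 'rV[R]_2) : 'rV[R]_3 := 'D_(vec2 1 0) p x.
Definition partial_v (x : 'rV[R]_2) : 'rV[R]_3 := 'D_(vec2 0 1) p x.

Definition surface_normal (x : 'rV[R]_2) : 'rV[R]_3 :=
  crossv (partial_u x) (partial_v x).

Definition regular_patch : Prop :=
  forall x, simplex x -> free [:: partial_u x; partial_v x].

Definition tangent_perp (x : 'rV[R]_2) (a : 'rV[R]_3) : Prop :=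
  forall d : 'rV[R]_2, dotv ('D_d p x) a = 0.

(* The corners (1,0), (0,1), (0,0) of the simplex are sent to a0, a1, a2;
   its edges u + v = 1, v = 0, u = 0 join a0 to a1, a0 to a2, a1 to a2. *)
Definition G1_admissible (a0 a1 a2 : 'rV[R]_3) : Prop :=
  [/\ regular_patch,
      [/\ tangent_perp (vec2 1 0) a0, tangent_perp (vec2 0 1) a1
        & tangent_perp (vec2 0 0) a2]
    & forall x, simplex x ->
      [/\ x 0 0 + x 0 1 = 1 -> surface_normal x \in <<[:: a0; a1]>>%VS,
          x 0 1 = 0 -> surface_normal x \in <<[:: a0; a2]>>%VS
        & x 0 0 = 0 -> surface_normal x \in <<[:: a1; a2]>>%VS]].

End Admissible.

(* Main.v *)
Require Import Defs.
From mathcomp Require Import all_boot all_order all_algebra.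
From mathcomp Require Import all_classical all_reals all_analysis.
From mathcomp Require Import ring lra.
Import Order.TTheory GRing.Theory Num.Theory.
Import numFieldNormedType.Exports.
Local Open Scope ring_scope.

(** In barycentric coordinates [(u, v, w)] the patch is a combination of the
    vertices whose coefficients are cubic forms; the inner control point enters
    as [g (v0 + v1 + v2)] with [g = gamma / (3 height c)], and the Gram matrix
    of the vertices has a single off-diagonal entry [k].

    Tangency at the vertices means [alpha + beta k = 1].  By Binet-Cauchy, the
    component of the normal orthogonal to the plane of an edge is then [u v]
    times a symmetric quadratic form on that edge, whose two coefficients must
    vanish.  Both are affine in [g]; eliminating it leaves [beta = 0],
    [beta = 2 / (1 + k)] or [beta = 2 / (3 (1 + k))].  In the first case the
    patch is singular at the vertices, in the second at the midpoints of the
    edges.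

    For the third value [3 alpha = 1 + 3 beta], and the projection of the patch
    to the horizontal plane does not depend on [g] and has Jacobian proportional
    to [3 beta (4 - 3 beta) + 4 (3 beta - 1)^2 (u v + v w + w u)], which is
    positive on the triangle because [1/3 < beta < 4/3]. *)

(** * Vector algebra in three-space *)

Section Vectors.
Variable R : realType.
Implicit Types (a b d : R) (x y n : 'rV[R]_3).

Lemma vec2E0 a b : vec2 a b 0 0 = a. Proof. by rewrite mxE. Qed.
Lemma vec2E1 a b : vec2 a b 0 1 = b. Proof. by rewrite mxE. Qed.
Lemma vec3E0 a b d : vec3 a b d 0 0 = a. Proof. by rewrite mxE. Qed.
Lemma vec3E1 a b d : vec3 a b d 0 1 = b. Proof. by rewrite mxE. Qed.
Lemma vec3E2 a b d : vec3 a b d 0 2%:R = d. Proof. by rewrite mxE. Qed.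

Definition vecE := (vec2E0, vec2E1, vec3E0, vec3E1, vec3E2).

Lemma row3P x y :
  x 0 0 = y 0 0 -> x 0 1 = y 0 1 -> x 0 2%:R = y 0 2%:R -> x = y.
Proof.
move=> e0 e1 e2; apply/rowP => -[[|[|[|//]]] lti].
- by rewrite (_ : Ordinal lti = 0) //; exact: val_inj.
- by rewrite (_ : Ordinal lti = 1) //; exact: val_inj.
- by rewrite (_ : Ordinal lti = 2%:R) //; exact: val_inj.
Qed.

Lemma dotvE x y :
  dotv x y = x 0 0 * y 0 0 + x 0 1 * y 0 1 + x 0 2%:R * y 0 2%:R.
Proof.
rewrite /dotv !big_ord_recl big_ord0 addr0 addrA.
by congr (_ * _ + _ * _ + _ * _); congr (fun_of_matrix _ _ _); exact: val_inj.
Qed.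

Lemma dotvC x y : dotv x y = dotv y x.
Proof. by rewrite !dotvE !(mulrC (x _ _)). Qed.

Lemma crossvZl a x y : crossv (a *: x) y = a *: crossv x y.
Proof. by apply: row3P; rewrite !(mxE, vecE) /=; ring. Qed.

Lemma crossvv x : crossv x x = 0.
Proof. by apply: row3P; rewrite !(mxE, vecE) /=; ring. Qed.

Lemma dotv_crossv_crossv x y z t :
  dotv (crossv x y) (crossv z t)
  = dotv x z * dotv y t - dotv x t * dotv y z.
Proof. by rewrite !dotvE !vecE; ring. Qed.

Lemma free_crossv_neq0 x y : crossv x y != 0 -> free [:: x; y].
Proof.
move=> nz; rewrite free_cons span_seq1 free_cons span_nil.
have y0 : y != 0.
  apply: contraNneq nz => ->; apply/eqP.
  by apply: row3P; rewrite !(mxE, vecE) /=; ring.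
rewrite memv0 y0 nil_free !andbT.
apply: contra nz => /vlineP[k ->].
by rewrite crossvZl crossvv scaler0.
Qed.

(* Cramer's rule in the basis [a], [b], [crossv a b]. *)
Lemma mem_span2_crossv x (a b : 'rV[R]_3) :
  dotv (crossv a b) (crossv a b) != 0 ->
  (x \in <<[:: a; b]>>%VS) <-> dotv x (crossv a b) = 0.
Proof.
move=> nz; split.
  rewrite span_cons span_seq1 => /memv_addP[_ /vlineP[k ->]].
  move=> [_ /vlineP[l ->] ->].
  by rewrite !dotvE !(mxE, vecE) /=; ring.
move=> x0; set n := crossv a b in nz x0 *.
have -> : x = (dotv (crossv x b) n / dotv n n) *: a
            + (dotv (crossv a x) n / dotv n n) *: b.
  apply: (scalerI nz); rewrite scalerDr !scalerA !(mulrCA (dotv n n)) mulfV //.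
  rewrite !mulr1 -[RHS]addr0 -(scale0r n) -x0 /n.
  by apply: row3P; rewrite !dotvE !(mxE, vecE) /=; ring.
by rewrite memvD // memvZ // memv_span // !inE eqxx ?orbT.
Qed.

Lemma free2_neq0 x y : free [:: x; y] -> x != 0.
Proof. by move/free_not0; apply; rewrite !inE eqxx. Qed.

Lemma free2_neq x y : free [:: x; y] -> x != y.
Proof. by move/free_uniq; rewrite /= inE andbT. Qed.

End Vectors.

(** * Directional derivatives from cubic expansions *)

(** For [h != 0] the difference quotient is [f1 + h *: f2 + h ^+ 2 *: f3], which tends to [f1];
    derivatives of the patch can thus be read off an algebraic identity. *)
Lemma derive_cubic_expansion (R : realType) (V W : normedModType R)
    (f : V -> W) (x d : V) (f1 f2 f3 : W) :
  (forall h : R,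
    f (h *: d + x) = f x + h *: f1 + h ^+ 2 *: f2 + h ^+ 3 *: f3) ->
  'D_d f x = f1.
Proof.
move=> fE; apply: cvg_lim => //.
have : ((fun h : R => f1 + h *: f2 + h ^+ 2 *: f3)%R @ (0 : R)^'
        --> f1)%classic.
  rewrite -[X in (_ --> X)%classic]addr0 -[X in (_ --> X)%classic]addr0.
  apply: cvgD; first apply: cvgD; first exact: cvg_cst.
    rewrite -[X in (_ --> X)%classic](scale0r f2); apply: cvgZr_tmp.
    exact: cvg_within.
  have e0 : (0 : R) ^+ 2 = 0 by rewrite expr0n.
  rewrite -[X in (_ --> X)%classic](scale0r f3) -[X in X *: _]e0.
  apply: cvgZr_tmp; apply: cvg_trans (@exprn_continuous R 2 0).
  by apply: cvg_app; exact: cvg_within.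
apply: cvg_trans; apply: near_eq_cvg; near=> h.
have h0 : h != 0 by near: h; exact: nbhs_dnbhs_neq.
symmetry; rewrite /= fE -2!(addrA (f x)) (addrAC (f x)) subrr add0r.
rewrite !scalerDr !scalerA mulVf // scale1r.
by rewrite !exprS expr0 !mulr1 !mulrA mulVf // mul1r.
Unshelve. all: by end_near. Qed.

(** * The patch and its differential in barycentric coordinates *)

Section BarycentricForm.
Variable R : realType.
Implicit Types (c al be g u v w : R).

(** The coefficient of [v0 c]. It is symmetric in [v] and [w], so cyclic shifts of the arguments
    give those of [v1 c] and [v2 c]. *)
Definition coord al be g u v w : R :=
  u ^+ 3 + 3 * al * u ^+ 2 * (v + w) + 3 * be * u * (v ^+ 2 + w ^+ 2)
  + 6 * g * u * v * w.

Definition dcoord al be g u v w du dv dw : R :=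
  3 * u ^+ 2 * du
  + 3 * al * (2 * u * du * (v + w) + u ^+ 2 * (dv + dw))
  + 3 * be * (du * (v ^+ 2 + w ^+ 2) + 2 * u * (v * dv + w * dw))
  + 6 * g * (du * v * w + u * dv * w + u * v * dw).

(* Taylor's formula for a cubic form: its second-order term at [x] along [d]
   is its first-order term at [d] along [x]. *)
Lemma coord_expansion al be g u v w du dv dw (h : R) :
  coord al be g (h * du + u) (h * dv + v) (h * dw + w)
  = coord al be g u v w + h * dcoord al be g u v w du dv dw
    + h ^+ 2 * dcoord al be g du dv dw u v w
    + h ^+ 3 * coord al be g du dv dw.
Proof. by rewrite /coord /dcoord; ring. Qed.

Definition combv c a b d : 'rV[R]_3 := a *: v0 c + b *: v1 c + d *: v2 c.

Definition height c : R := Num.sqrt (1 - c ^+ 2).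

Definition patch_bary c al be g u v w : 'rV[R]_3 :=
  combv c (coord al be g u v w) (coord al be g v w u) (coord al be g w u v).

Definition dpatch_bary c al be g u v w du dv dw : 'rV[R]_3 :=
  combv c (dcoord al be g u v w du dv dw) (dcoord al be g v w u dv dw du)
          (dcoord al be g w u v dw du dv).

Lemma height_gt0 c : 0 < c -> c < 1 -> 0 < height c.
Proof.
by move=> c0 c1; rewrite sqrtr_gt0 subr_gt0 expr_lt1 // ltW.
Qed.

(** The horizontal parts of the vertices cancel in their sum [(0, 0, 3 height c)]; this accounts for
    the factor [gamma / (3 * height c)]. *)
Lemma cubic_patchE c al be gamma x : 0 < c -> c < 1 ->
  cubic_patch c al be gamma x
  = patch_bary c al be (gamma / (3 * height c)) (x 0 0) (x 0 1)
      (1 - x 0 0 - x 0 1).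
Proof.
move=> c0 c1; have h0 := lt0r_neq0 (height_gt0 _ c0 c1).
rewrite /cubic_patch.
under eq_bigr do under eq_bigr do rewrite big_mkcond.
rewrite !(big_ord_recl, big_ord0) /= !(addr0, add0r).
rewrite /patch_bary /combv /v0 /v1 /v2 -/(height c).
set u := x 0 0; set v := x 0 1.
apply: row3P; rewrite !(mxE, vecE) /= !factS fact0 /bump /coord /=; by field.
Qed.

Lemma derive_cubic_patch c al be gamma x (d : 'rV[R]_2) : 0 < c -> c < 1 ->
  'D_d (cubic_patch c al be gamma) x
  = dpatch_bary c al be (gamma / (3 * height c)) (x 0 0) (x 0 1)
      (1 - x 0 0 - x 0 1) (d 0 0) (d 0 1) (- d 0 0 - d 0 1).
Proof.
move=> c0 c1; set g := gamma / _.
set u := x 0 0; set v := x 0 1; set w := 1 - u - v.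
set du := d 0 0; set dv := d 0 1; set dw := - du - dv.
apply: (@derive_cubic_expansion _ _ _ _ _ _ _
  (dpatch_bary c al be g du dv dw u v w) (patch_bary c al be g du dv dw)).
move=> h; rewrite !cubic_patchE // !mxE -/g -/u -/v -/w -/du -/dv.
have -> : 1 - (h * du + u) - (h * dv + v) = h * dw + w by rewrite /dw /w; ring.
rewrite /patch_bary /dpatch_bary !coord_expansion /combv.
by apply: row3P; rewrite !mxE; ring.
Qed.

(** * Gram matrix of the vertices and planes of the edges *)

(** The cosine of the sides of the spherical triangle. *)
Definition vertex_dot c : R := 1 - 3 * c ^+ 2 / 2.

Lemma dotv_combv c a b d : 0 < c -> c < 1 ->
  [/\ dotv (combv c a b d) (v0 c) = a + vertex_dot c * (b + d),
      dotv (combv c a b d) (v1 c) = b + vertex_dot c * (a + d)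
    & dotv (combv c a b d) (v2 c) = d + vertex_dot c * (a + b)].
Proof.
move=> c0 c1.
have hE : height c ^+ 2 = 1 - c ^+ 2.
  by rewrite sqr_sqrtr // subr_ge0 expr_le1 // ltW.
have sE : Num.sqrt (3 : R) ^+ 2 = 3 by rewrite sqr_sqrtr.
rewrite /combv /v0 /v1 /v2 -/(height c) /vertex_dot !dotvE !(mxE, vecE) /=.
by split; field: hE sE.
Qed.

Lemma dotv_vertices c : 0 < c -> c < 1 ->
  [/\ dotv (v0 c) (v0 c) = 1, dotv (v1 c) (v1 c) = 1
    & dotv (v2 c) (v2 c) = 1]
  /\ [/\ dotv (v0 c) (v1 c) = vertex_dot c, dotv (v0 c) (v2 c) = vertex_dot c
    & dotv (v1 c) (v2 c) = vertex_dot c].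
Proof.
move=> c0 c1.
have [] := dotv_combv c 1 0 0 c0 c1; have [] := dotv_combv c 0 1 0 c0 c1.
have [_ _] := dotv_combv c 0 0 1 c0 c1.
rewrite /combv !scale1r !scale0r !addr0 !add0r !mulr0 !mulr1 !addr0.
by move=> -> _ -> -> -> -> ->.
Qed.

Lemma vertex_dot_bounds c : 0 < c -> c < 1 ->
  - (1 / 2) < vertex_dot c /\ vertex_dot c < 1.
Proof.
move=> c0 c1; have c2 : 0 < c ^+ 2 by rewrite exprn_gt0.
have c2' : c ^+ 2 < 1 by rewrite expr_lt1 // ltW.
by rewrite /vertex_dot; split; lra.
Qed.

Lemma mem_span_vertices c (x : 'rV[R]_3) : 0 < c -> c < 1 ->
  [/\ (x \in <<[:: v0 c; v1 c]>>%VS) <-> dotv x (crossv (v0 c) (v1 c)) = 0,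
      (x \in <<[:: v0 c; v2 c]>>%VS) <-> dotv x (crossv (v0 c) (v2 c)) = 0
    & (x \in <<[:: v1 c; v2 c]>>%VS) <-> dotv x (crossv (v1 c) (v2 c)) = 0].
Proof.
move=> c0 c1; have [k0 k1] := vertex_dot_bounds _ c0 c1.
have nz : 1 - vertex_dot c ^+ 2 != 0.
  by apply: lt0r_neq0; nra.
have [[d00 d11 d22] [d01 d02 d12]] := dotv_vertices c c0 c1.
split; apply: mem_span2_crossv; rewrite dotv_crossv_crossv.
- by rewrite (@dotvC _ (v1 c)) d00 d11 d01 mulr1 -expr2.
- by rewrite (@dotvC _ (v2 c)) d00 d22 d02 mulr1 -expr2.
- by rewrite (@dotvC _ (v2 c)) d11 d22 d12 mulr1 -expr2.
Qed.

(** * Components of the surface normal and the edge equations *)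

(** The horizontal projections of the vertices sum to zero, so [v2] can be eliminated, leaving
    coefficients [a - d] and [b - d]; the prefactor is the planar cross product of the projected
    [v0] and [v1]. *)
Lemma crossv_combv2 c a b d a' b' d' :
  crossv (combv c a b d) (combv c a' b' d') 0 2%:R
  = c ^+ 2 * Num.sqrt 3 / 2
    * ((a - d) * (b' - d') - (b - d) * (a' - d')).
Proof.
rewrite /combv /v0 /v1 /v2 !(mxE, vecE) /=.
by field.
Qed.

Lemma partialsE c al be gamma (x : 'rV[R]_2) : 0 < c -> c < 1 ->
  let dp := dpatch_bary c al be (gamma / (3 * height c)) (x 0 0) (x 0 1)
              (1 - x 0 0 - x 0 1) in
  partial_u (cubic_patch c al be gamma) x = dp 1 0 (- 1) /\
  partial_v (cubic_patch c al be gamma) x = dp 0 1 (- 1).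
Proof.
move=> c0 c1; rewrite /partial_u /partial_v !derive_cubic_patch // !vecE.
by rewrite !subr0 oppr0 sub0r.
Qed.

Definition edge_even k al be g : R :=
  2 * (al - be) * (2 * (al + be) * (1 + k) - 4 * g * (1 + 2 * k))
  + be ^+ 2 * (1 + k) * (1 - k) ^+ 2.

Definition edge_square k al be g : R :=
  be * (2 * (al - be) * (1 - k) ^+ 2
        + (1 + k) * (2 * (al + be) * (1 + k) - 4 * g * (1 + 2 * k))).

Definition edge_poly k al be g u v : R :=
  9 / 2 * (1 - k) * u * v
  * (2 * u * v * edge_even k al be g
     + (u ^+ 2 + v ^+ 2) * edge_square k al be g).

(** Tangency makes the normal at each end of an edge a multiple of the vertex there, hence in the
    edge plane; this gives the quartic its factor [u v]. The minus sign arises because [v0], [v2] is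
    against the cyclic order. *)
Lemma normal_edge c al be g u v w (k := vertex_dot c) : 0 < c -> c < 1 ->
  al + be * k = 1 ->
  let n := crossv (dpatch_bary c al be g u v w 1 0 (- 1))
             (dpatch_bary c al be g u v w 0 1 (- 1)) in
  [/\ w = 0 -> dotv n (crossv (v0 c) (v1 c)) = edge_poly k al be g u v,
      v = 0 -> dotv n (crossv (v0 c) (v2 c)) = - edge_poly k al be g u w
    & u = 0 -> dotv n (crossv (v1 c) (v2 c)) = edge_poly k al be g v w].
Proof.
move=> c0 c1 alE n.
have {}alE : al = 1 - be * k by rewrite -alE addrK.
rewrite /n !dotv_crossv_crossv /dpatch_bary.
have [-> -> ->] := dotv_combv c (dcoord al be g u v w 1 0 (- 1))
  (dcoord al be g v w u 0 (- 1) 1) (dcoord al be g w u v (- 1) 1 0) c0 c1.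
have [-> -> ->] := dotv_combv c (dcoord al be g u v w 0 1 (- 1))
  (dcoord al be g v w u 1 (- 1) 0) (dcoord al be g w u v (- 1) 0 1) c0 c1.
rewrite -/k alE /dcoord /edge_poly /edge_even /edge_square.
by split=> ->; field.
Qed.

(** The [g] terms of the three coordinates are equal, so they cancel in the differences of
    [crossv_combv2]. *)
Lemma normal_height c al be g u v w : 3 * al = 1 + 3 * be -> u + v + w = 1 ->
  crossv (dpatch_bary c al be g u v w 1 0 (- 1))
         (dpatch_bary c al be g u v w 0 1 (- 1)) 0 2%:R
  = c ^+ 2 * Num.sqrt 3 / 2
    * (3 * be * (4 - 3 * be)
       + 4 * (3 * be - 1) ^+ 2 * (u * v + v * w + w * u)).
Proof.
move=> alE uvw; rewrite crossv_combv2; congr (_ * _).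
have -> : al = (1 + 3 * be) / 3 by rewrite -alE; field.
have -> : w = 1 - u - v by rewrite -uvw; ring.
by rewrite /dcoord; field.
Qed.

(* The second root of the quadratic left after eliminating [g], namely
   [be = 2 / (1 + k)], is the one excluded by [nd]. *)
Lemma edge_system_solution k al be g : - (1 / 2) < k -> k < 1 ->
  al + be * k = 1 -> be != 0 -> 2 * (al - be) + be * (1 + k) != 0 ->
  edge_even k al be g = 0 -> edge_square k al be g = 0 ->
  3 * be * (1 + k) = 2
  /\ 4 * g * (1 + 2 * k) = 2 * (al + be) * (1 + k) + be * (1 - k) ^+ 2.
Proof.
move=> k0 k1 alE be0 nd ev /eqP; rewrite mulf_eq0 (negPf be0) /= => /eqP sq.
set M := 2 * (al + be) * (1 + k) - 4 * g * (1 + 2 * k) in sq.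
have k1n0 : 1 - k != 0 by rewrite lt0r_neq0 // subr_gt0.
have kp0 : 1 + k != 0 by apply: lt0r_neq0; lra.
(* This combination of the two equations cancels [M], the only term containing [g], and leaves a
   difference of squares. *)
have : (1 - k) ^+ 2 * (2 * (al - be) + be * (1 + k))
       * (be * (1 + k) - 2 * (al - be)) = 0.
  transitivity ((1 + k) * edge_even k al be g
    - 2 * (al - be) * (2 * (al - be) * (1 - k) ^+ 2 + (1 + k) * M)).
    by rewrite /edge_even /M; ring.
  by rewrite ev sq !mulr0 subr0.
move/eqP; rewrite !mulf_eq0 (negPf k1n0) (negPf nd) /= => /eqP dE.
have bE : 3 * be * (1 + k) = 2.
  have -> : 3 * be * (1 + k) = be * (1 + k) - 2 * (al - be)
    + 2 * (al + be * k) by ring.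
  by rewrite dE alE; ring.
split=> //; apply/eqP; rewrite eq_sym -subr_eq0; apply/eqP/(mulfI kp0).
rewrite mulr0 -[RHS]sq.
have -> : 2 * (al - be) = be * (1 + k) by apply/esym/eqP; rewrite -subr_eq0 dE.
by rewrite /M; ring.
Qed.

(** The ratio of [2 u v] to [u ^+ 2 + v ^+ 2] differs at the two sample points, so they give
    independent linear equations. *)
Lemma edge_poly_eq0 k al be g : k < 1 ->
  edge_poly k al be g (1 / 2) (1 / 2) = 0 ->
  edge_poly k al be g (1 / 3) (2 / 3) = 0 ->
  edge_even k al be g = 0 /\ edge_square k al be g = 0.
Proof.
move=> k1; have k1n0 : 1 - k != 0 by rewrite lt0r_neq0 // subr_gt0.
rewrite /edge_poly; set X := edge_even _ _ _ _; set Y := edge_square _ _ _ _.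
have cancel (r s : R) : r != 0 -> 9 / 2 * (1 - k) * r * s = 0 -> s = 0.
  move=> r0 /eqP; rewrite !mulf_eq0 (negPf k1n0) (negPf r0) !orbF /= => /orP[|].
    by rewrite invr_eq0 !pnatr_eq0.
  by move/eqP.
rewrite -2!(mulrA (9 / 2 * (1 - k))) !(mulrA (9 / 2 * (1 - k))).
move=> h1 h2.
have {}h1 : 2 * (1 / 2) * (1 / 2) * X + ((1 / 2) ^+ 2 + (1 / 2) ^+ 2) * Y = 0.
  apply: (@cancel (1 / 2 * (1 / 2))); last by rewrite -[RHS]h1; ring.
  by apply: lt0r_neq0; lra.
have {}h2 : 2 * (1 / 3) * (2 / 3) * X + ((1 / 3) ^+ 2 + (2 / 3) ^+ 2) * Y = 0.
  apply: (@cancel (1 / 3 * (2 / 3))); last by rewrite -[RHS]h2; ring.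
  by apply: lt0r_neq0; lra.
by split; lra.
Qed.

(** * Necessity *)

(** If [be = 0], then [partial_u] vanishes at a corner. If the other quantity is zero, the edge
    curve stops at its midpoint, where [partial_u] and [partial_v] then coincide. *)
Lemma regular_coefficients c al be gamma (k := vertex_dot c) :
  0 < c -> c < 1 -> al + be * k = 1 ->
  regular_patch (cubic_patch c al be gamma) ->
  be != 0 /\ 2 * (al - be) + be * (1 + k) != 0.
Proof.
move=> c0 c1 alE reg; split; apply/eqP => be0.
- have alE1 : al = 1 by rewrite -alE be0 mul0r addr0.
  have /reg /free2_neq0 /eqP : simplex (vec2 (1 : R) 0).
    by rewrite /simplex /= !vecE; split; lra.
  apply; have [-> _] := partialsE c al be gamma (vec2 1 0) c0 c1.
  rewrite !vecE be0 alE1 /dpatch_bary /dcoord /combv.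
  by apply: row3P; rewrite !mxE; ring.
- have /reg /free2_neq /eqP : simplex (vec2 (1 / 2 : R) (1 / 2)).
    by rewrite /simplex /= !vecE; split; lra.
  apply; have [-> ->] := partialsE c al be gamma (vec2 (1 / 2) (1 / 2)) c0 c1.
  rewrite !vecE /dpatch_bary /combv.
  have {}alE : al = 1 - be * k by rewrite -alE addrK.
  (* This is [1 + al - be], the factor of [v0 - v1] in the velocity of the edge curve at its
     midpoint. *)
  have {}be0 : 2 - be * k - be = 0 by rewrite -[RHS]be0 alE; ring.
  by congr (_ *: _ + _ *: _ + _ *: _); rewrite /dcoord alE; lra.
Qed.

Lemma G1_necessary c al be gamma (k := vertex_dot c) :
  0 < c -> c < 1 ->
  G1_admissible (cubic_patch c al be gamma) (v0 c) (v1 c) (v2 c) ->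
  let g := gamma / (3 * height c) in
  [/\ al + be * k = 1, 3 * be * (1 + k) = 2
    & 4 * g * (1 + 2 * k) = 2 * (al + be) * (1 + k) + be * (1 - k) ^+ 2].
Proof.
move=> c0 c1 [reg [/(_ (vec2 1 0)) tan _ _] bd] g.
have [k0 k1] := vertex_dot_bounds c c0 c1.
(* At the corner [(1, 0)] the derivative along [vec2 1 0] is [3 (1 - al) v0 - 3 be v2]. *)
have alE : al + be * k = 1.
  move: tan; rewrite derive_cubic_patch // -/g !vecE.
  rewrite /dpatch_bary; set a := dcoord _ _ _ _ _ _ _ _ _.
  set b := dcoord _ _ _ _ _ _ _ _ _; set d := dcoord _ _ _ _ _ _ _ _ _.
  have [-> _ _] := dotv_combv c a b d c0 c1.
  rewrite /a /b /d /dcoord -/k => tan.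
  by lra.
have [be0 nd] := regular_coefficients c al be gamma c0 c1 alE reg.
have edge (u v : R) : 0 <= u -> 0 <= v -> u + v = 1 ->
    edge_poly k al be g u v = 0.
  move=> u0 v0' uv.
  have Sx : simplex (vec2 u v) by rewrite /simplex /= !vecE; split; lra.
  have [+ _ _] := bd _ Sx; rewrite !vecE => /(_ uv).
  have [-> _ _] := mem_span_vertices c
    (surface_normal (cubic_patch c al be gamma) (vec2 u v)) c0 c1.
  rewrite /surface_normal.
  have [-> ->] := partialsE c al be gamma (vec2 u v) c0 c1.
  rewrite !vecE -/g.
  have [nE _ _] := normal_edge c al be g u v (1 - u - v) c0 c1 alE.
  by rewrite nE //; lra.
have [|| ev sq] := edge_poly_eq0 k al be g k1; try by apply: edge; lra.
by have [bE gE] := edge_system_solution k al be g k0 k1 alE be0 nd ev sq; split.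
Qed.

(** * Sufficiency *)

Lemma G1_sufficient c al be gamma (k := vertex_dot c) :
  0 < c -> c < 1 ->
  let g := gamma / (3 * height c) in
  al + be * k = 1 -> 3 * be * (1 + k) = 2 ->
  4 * g * (1 + 2 * k) = 2 * (al + be) * (1 + k) + be * (1 - k) ^+ 2 ->
  G1_admissible (cubic_patch c al be gamma) (v0 c) (v1 c) (v2 c).
Proof.
move=> c0 c1 g alE bE gE.
have [] := vertex_dot_bounds c c0 c1; rewrite -/k => k0 k1.
have alE' : 3 * al = 1 + 3 * be by lra.
have {}gE : 2 * (al + be) * (1 + k) - 4 * g * (1 + 2 * k) = - be * (1 - k) ^+ 2.
  by rewrite gE; ring.
have dE : 2 * (al - be) = be * (1 + k) by lra.
have ev : edge_even k al be g = 0 by rewrite /edge_even gE dE; ring.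
have sq : edge_square k al be g = 0 by rewrite /edge_square gE dE; ring.
have edge0 u v : edge_poly k al be g u v = 0.
  by rewrite /edge_poly ev sq !mulr0 addr0 mulr0.
have be_gt0 : 0 < be.
  have kp : 0 < 1 + k by lra.
  by rewrite -(pmulr_lgt0 _ kp); lra.
(* Since [be (1 + k) = 2 / 3], the positive number [be (k + 1 / 2)] equals [2 / 3 - be / 2]. *)
have be_lt : 0 < 4 - 3 * be.
  have : 0 < be * (k + 1 / 2) by rewrite mulr_gt0 //; lra.
  by lra.
split.
- move=> x [/andP[u0 u1] /andP[w0 w1] uv1].
  have [-> ->] := partialsE c al be gamma x c0 c1; rewrite -/g.
  set u := x 0 0 in u0 u1 uv1 *; set v := x 0 1 in w0 w1 uv1 *.
  set w := 1 - u - v; have w_ge0 : 0 <= w by rewrite /w; lra.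
  (* A zero normal would have zero height, but [normal_height] makes it positive. *)
  apply: free_crossv_neq0; apply/eqP => /rowP/(_ 2%:R) /eqP.
  rewrite (normal_height c al be g u v w alE') ?mxE; last by rewrite /w; ring.
  apply/negP/lt0r_neq0; rewrite !mulr_gt0 ?exprn_gt0 ?sqrtr_gt0 //.
  have q_ge0 : 0 <= u * v + v * w + w * u by rewrite !addr_ge0 // mulr_ge0.
  apply: ltr_wpDr; first by rewrite mulr_ge0 // mulr_ge0 // sqr_ge0.
  by rewrite !mulr_gt0.
- split=> d; rewrite derive_cubic_patch // -/g !vecE /dpatch_bary;
    set a := dcoord _ _ _ _ _ _ _ _ _; set b := dcoord _ _ _ _ _ _ _ _ _;
    set e := dcoord _ _ _ _ _ _ _ _ _;
    have [p0 p1 p2] := dotv_combv c a b e c0 c1;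
    rewrite ?(p0, p1, p2) /a /b /e /dcoord -/k (_ : al = 1 - be * k);
    [ring|lra|ring|lra|ring|lra].
- move=> x _; rewrite /surface_normal.
  have [-> ->] := partialsE c al be gamma x c0 c1; rewrite -/g.
  set u := x 0 0; set v := x 0 1; set w := 1 - u - v.
  have [n01 n02 n12] := normal_edge c al be g u v w c0 c1 alE.
  set n := crossv _ _ in n01 n02 n12 *.
  have [s01 s02 s12] := mem_span_vertices c n c0 c1.
  split=> h.
  + by apply/s01; rewrite n01 ?edge0 // /w; lra.
  + by apply/s02; rewrite n02 ?edge0 ?oppr0.
  + by apply/s12; rewrite n12 ?edge0.
Qed.

(** * Closed forms of the coefficients *)

(** Here [1 + k = (4 - 3 c ^+ 2) / 2] and [1 + 2 k = 3 (1 - c ^+ 2)] are nonzero, so the equations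
    determine [be], then [al], then [g]; these are the factors in the denominators. *)
Lemma coefficients_closed_form c al be gamma (k := vertex_dot c) :
  0 < c -> c < 1 ->
  let g := gamma / (3 * height c) in
  [/\ al + be * k = 1, 3 * be * (1 + k) = 2
    & 4 * g * (1 + 2 * k) = 2 * (al + be) * (1 + k) + be * (1 - k) ^+ 2] <->
  [/\ al = (8 - 3 * c ^+ 2) / (3 * (4 - 3 * c ^+ 2)),
      be = 4 / (3 * (4 - 3 * c ^+ 2))
    & gamma = height c * (8 - 8 * c ^+ 2 + 3 * c ^+ 4)
              / (2 * (1 - c ^+ 2) * (4 - 3 * c ^+ 2))].
Proof.
move=> c0 c1 g.
have c2 : c ^+ 2 < 1 by rewrite expr_lt1 // ltW.
have nz1 : 4 - 3 * c ^+ 2 != 0 by apply: lt0r_neq0; lra.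
have nz2 : 1 - c ^+ 2 != 0 by apply: lt0r_neq0; lra.
have h0 : height c != 0 by rewrite lt0r_neq0 ?height_gt0.
have gamE : gamma = 3 * height c * g by rewrite /g; field.
rewrite {}/k /vertex_dot; split=> [[alE bE gE]|[alE bE gE]].
- have {}bE : be = 4 / (3 * (4 - 3 * c ^+ 2)).
    apply: (mulIf nz1); transitivity (4 / 3 : R); last by field.
    by lra.
  have {}alE : al = (8 - 3 * c ^+ 2) / (3 * (4 - 3 * c ^+ 2)).
    transitivity (1 - be * (1 - 3 * c ^+ 2 / 2)); first by lra.
    by rewrite bE; field.
  split=> //; rewrite gamE.
  have -> : g = 4 * g * (1 + 2 * (1 - 3 * c ^+ 2 / 2)) / (12 * (1 - c ^+ 2)).
    by field.
  by rewrite gE alE bE; field; rewrite nz1 nz2.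
- split; rewrite ?alE ?bE /g ?gE; field; rewrite ?nz1 ?nz2 ?h0 //.
Qed.

End BarycentricForm.

Theorem mainTheorem2 (R : realType) (c : R) (hc0 : 0 < c) (hc1 : c < 1)
    (alpha beta gamma : R) :
  G1_admissible (cubic_patch c alpha beta gamma) (v0 c) (v1 c) (v2 c) <->
  [/\ alpha = (8 - 3 * c ^+ 2) / (3 * (4 - 3 * c ^+ 2)),
      beta = 4 / (3 * (4 - 3 * c ^+ 2))
    & gamma = Num.sqrt (1 - c ^+ 2) * (8 - 8 * c ^+ 2 + 3 * c ^+ 4)
              / (2 * (1 - c ^+ 2) * (4 - 3 * c ^+ 2))].
Proof.
rewrite -/(height R c).
apply: iff_trans (coefficients_closed_form R c alpha beta gamma hc0 hc1).
split=> [/(G1_necessary _ _ _ _ _ hc0 hc1) //|[]].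
exact: G1_sufficient.
Qed.
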